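(* Let $T$ be a labeled tree, i.e. a finite tree in which each vertex is labeled $\{1,1\}$, $\{2,2\}$ or $\{1,2\}$; vertices labeled $\{1,2\}$ are called marked and the other vertices unmarked. Then $T$ is an intersection graph for a chord diagram on two components (i.e. $T$ is isomorphic, as a labeled graph, to $\Gamma(D)$ for some chord diagram $D$ with two components) if and only if it satisfies the following three conditions: (1) The underlying marked tree is an intersection graph (i.e. it is isomorphic, as a marked graph, to the marked intersection graph of some chord diagram on two components). (2) Adjacent unmarked vertices have the same label. (3) If $S$ is a spine of $T$, and $v$ and $w$ are unmarked vertices in $S$, then the labels on $v$ and $w$ are the same if and only if there is an even number of marked vertices between them along $S$.
   Context: Chord diagrams. A chord diagram of degree $n$ with $k$ components is a disjoint union of $k$ oriented line segments (the components, labeled $1,\dots,k$), together with $n$ chords (unoriented line segments whose two endpoints lie on the components), such that all $2n$ endpoints of chords are distinct. The diagram is determined by the (linear) orders of the endpoints along each component, together with the pairing of endpoints into chords. The two endpoints of a chord may lie on the same component or on different components. Intersection graphs. The intersection graph $\Gamma(D)$ of a chord diagram $D$ is the labeled directed multigraph with one vertex for each chord of $D$; the vertex of a chord is labeled by the unordered pair $\{i,j\}$ ($i=j$ allowed) of the labels of the components on which the endpoints of the chord lie. For distinct vertices $v_1,v_2$ there is a directed edge from $v_1$ to $v_2$ for each pair $(e_1,e_2)$ such that $e_1$ is an endpoint of the chord of $v_1$, $e_2$ is an endpoint of the chord of $v_2$, $e_1$ and $e_2$ lie on the same component, and the orientation of that component runs from $e_1$ to $e_2$. Edges are counted mod 2: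 two directed edges with the same direction between the same two vertices cancel. If two vertices are joined by a directed edge in each direction, this is regarded as a single undirected edge. For diagrams with two components every remaining edge is undirected in this sense, so the intersection graph is an undirected graph. Marked graphs. The underlying marked tree of a labeled tree (and the marked intersection graph of a two-component diagram) is obtained by remembering only the graph and which vertices are marked (labeled $\{1,2\}$), forgetting whether an unmarked vertex is labeled $\{1,1\}$ or $\{2,2\}$. Spines. A spine of a tree $T$ with marked vertices is a (simple) path in $T$ of maximal length among those whose first and last vertices are marked. If $T$ has a single marked vertex, that vertex is the spine; if it has no marked vertices, the spine is empty. *)

(* Defs.v *)
From mathcomp Require Import all_boot.

Set Implicit Arguments.
Unset Strict Implicit.
Unset Printing Implicit Defensive.

(** The two endpoints of the chord [c] are [(c, false)] and [(c, true)]; chords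
    are unoriented, and nothing below depends on which endpoint gets which
    name. *)
Notation endpoint n := ('I_n * bool)%type.

(** [strand D i] lists the endpoints lying on the component [i] in the order
    given by the orientation of that component; components are numbered from
    [0].  The [perm_eq] says that every endpoint lies on exactly one component
    and occurs there exactly once. *)
Record chord_diagram (n k : nat) := ChordDiagram {
  strand :> 'I_k -> seq (endpoint n);
  strandP : perm_eq (flatten [seq strand i | i <- enum 'I_k])
                    (enum {: endpoint n})
}.

(** [precedes D x y]: [x] and [y] lie on one component, whose orientation runs
    from [x] to [y]. *)
Definition precedes (n k : nat) (D : chord_diagram n k) (x y : endpoint n) :
    bool :=
  [exists i : 'I_k, [&& x \in D i, y \in D i & index x (D i) < index y (D i)]].

(** A label, i.e. an unordered pair [{i,j}] with [i = j] allowed, is encoded as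
    the set [[set i; j]]; thus [{i,i}] is the singleton [[set i]]. *)
Definition is_label (k : nat) (A : {set 'I_k}) : Prop :=
  exists i j : 'I_k, A = [set i; j].

Definition chord_label (n k : nat) (D : chord_diagram n k) (c : 'I_n) :
    {set 'I_k} :=
  [set i : 'I_k | [exists b : bool, (c, b) \in D i]].

Definition arrow_count (n k : nat) (D : chord_diagram n k) (v1 v2 : 'I_n) :
    nat :=
  #|[set p : bool * bool | precedes D (v1, p.1) (v2, p.2)]|.

(** Arrows are counted mod 2.  This is the directed adjacency relation; an
    undirected edge is a pair of opposite arrows. *)
Definition inter_edge (n k : nat) (D : chord_diagram n k) : rel 'I_n :=
  fun v1 v2 => (v1 != v2) && odd (arrow_count D v1 v2).

(** An undirected graph is a symmetric relation, so that requiring [f] to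
    preserve and reflect [e] is the right notion of isomorphism both for
    directed and for undirected graphs. *)
Definition decorated_iso (L : Type) (T U : finType)
    (e : rel T) (d : T -> L) (e' : rel U) (d' : U -> L) : Prop :=
  exists f : T -> U,
    [/\ bijective f,
        forall x y, e' (f x) (f y) = e x y
      & forall x, d' (f x) = d x].

Definition is_tree (T : finType) (e : rel T) : Prop :=
  [/\ 0 < #|T|,
      symmetric e /\ irreflexive e,
      forall x y, connect e x y
    & forall c : seq T, 2 < size c -> ~ ucycle e c].

Definition is_mark (A : {set 'I_2}) : bool := A == [set ord0; ord_max].

Definition marked (V : Type) (lab : V -> {set 'I_2}) : pred V :=
  fun v => is_mark (lab v).

Definition labeled_intersection_graph (T : finType) (e : rel T)
    (lab : T -> {set 'I_2}) : Prop :=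
  exists (n : nat) (D : chord_diagram n 2),
    decorated_iso e lab (inter_edge D) (chord_label D).

Definition marked_intersection_graph (T : finType) (e : rel T)
    (m : pred T) : Prop :=
  exists (n : nat) (D : chord_diagram n 2),
    decorated_iso e m (inter_edge D) (marked (chord_label D)).

(** A path is the nonempty list of its vertices. *)
Definition marked_path (T : finType) (e : rel T) (m : pred T) (s : seq T) :
    bool :=
  if s is x :: p then [&& path e x p, uniq s, m x & m (last x p)] else false.

Definition is_spine (T : finType) (e : rel T) (m : pred T) (s : seq T) : Prop :=
  if [exists x, m x] then
    marked_path e m s /\ (forall s', marked_path e m s' -> size s' <= size s)
  else s = [::].

(** The entries of [s] strictly between [v] and [w], whichever comes first. *)
Definition between (T : eqType) (s : seq T) (v w : T) : seq T :=
  drop (minn (index v s) (index w s)).+1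
    (take (maxn (index v s) (index w s)) s).

(* Main.v *)
Require Import Defs.
From mathcomp Require Import all_boot zify.

(* Laying out the first component followed by the second one reversed turns a
   diagram on two components into a family of intervals on a line with a cut:
   two chords are adjacent exactly when their intervals cross, and a chord is
   marked exactly when its interval contains the cut.

   Necessity.  Being nested under a chord [a] is constant along paths that avoid
   the closed neighborhood of [a].  On a path with marked ends this fixes, for
   every marked vertex, on which side of it the rest of the path lies, up to one
   global direction.  Hence every edge of the path takes place on a definite
   component, and that component changes exactly at the marked vertices.

   Sufficiency.  Start from a diagram realizing the marked tree and exchange its
   components, if needed, so that it agrees with [lab] on a spine.  The nesting
   argument and the maximality of the spine show that every marked vertex is at
   distance at most one from the spine, so a block of unmarked vertices off the
   spine has a single marked neighbor; such a block can be carried over to the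
   other endpoint of that neighbor, which flips its label. *)

Set Implicit Arguments.
Unset Strict Implicit.
Unset Printing Implicit Defensive.

(** * Interval models of two-component diagrams *)

Definition half (N i : nat) : 'I_2 := if i < N then ord0 else ord_max.

Definition crossing (a a' b b' : nat) : bool :=
  (a < b < a') && (a' < b') || (b < a < b') && (b' < a').

Definition crosses (T : Type) (lo hi : T -> nat) (x y : T) : bool :=
  crossing (lo x) (hi x) (lo y) (hi y).

(** The cut lies just before position [N]. Positions need not be consecutive, so only their relative
    order and their side of the cut matter. *)
Record chord_rep (T : finType) (e : rel T) (lab : T -> {set 'I_2})
    (lo hi : T -> nat) (N : nat) : Prop := ChordRep {
  rep_lt : forall x, lo x < hi x;
  rep_lo_inj : injective lo;
  rep_hi_inj : injective hi;
  rep_neq : forall x y, lo x <> hi y;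
  rep_edge : forall x y, e x y = crosses lo hi x y;
  rep_lab : forall x, lab x = [set half N (lo x); half N (hi x)]
}.

Definition representable (T : finType) (e : rel T) (lab : T -> {set 'I_2}) :
    Prop :=
  exists lo hi N, chord_rep e lab lo hi N.

(** The second component is read backwards so that two chords joining the components cross as
    intervals exactly when their orders on the two components are opposite, that is, when their
    arrow count is odd. *)
Definition unrolls (n : nat) (D : chord_diagram n 2) (P : endpoint n -> nat)
    (N : nat) : Prop :=
  [/\ injective P,
      forall i x, (x \in D i) = (half N (P x) == i)
    & forall i x y, x \in D i -> y \in D i ->
        (index x (D i) < index y (D i)) =
        if i == ord0 then P x < P y else P y < P x].

Lemma half_eq0 N i : (half N i == ord0) = (i < N).
Proof. by rewrite /half; case: ifP. Qed.

Lemma half_eq1 N i : (half N i == ord_max) = ~~ (i < N).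
Proof. by rewrite /half; case: ifP. Qed.

Lemma ord2P (i : 'I_2) : i = ord0 \/ i = ord_max.
Proof. by case: i => [[|[|//]] Hi]; [left|right]; apply: val_inj. Qed.

(** One term for the cut suffices: when [x] and [y] lie on different components, both terms equal
    the truth value of [N <= P y], and the sum is false. *)
Lemma unrolls_precedes n (D : chord_diagram n 2) P N x y :
  unrolls D P N -> x != y ->
  precedes D x y = (P x < P y) (+) (N <= P y).
Proof.
move=> [Pinj memD ltD] nxy.
have nP : P x != P y by rewrite (inj_eq Pinj).
apply/existsP/idP => [[i /and3P [xi yi]]|].
  rewrite ltD //; move: xi yi; rewrite !memD.
  by case: (ord2P i) => ->; rewrite ?half_eq0 ?half_eq1 /=; lia.
move=> H; have [yN|yN] := ltnP (P y) N.
  exists ord0; rewrite ltD !memD ?half_eq0 //=; lia.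
exists ord_max; rewrite ltD !memD ?half_eq1 //=; lia.
Qed.

Lemma card_pairs_bool (Q : bool -> bool -> bool) :
  #|[set p : bool * bool | Q p.1 p.2]| =
    Q false false + Q false true + Q true false + Q true true.
Proof.
rewrite cardsE -sum1_card big_mkcond /=.
rewrite -(pair_bigA _ (fun a b => if Q a b then 1 else 0)) !big_bool /=.
by case: (Q true true); case: (Q true false); case: (Q false true);
  case: (Q false false).
Qed.

(** Each term [N <= P y] occurs once for either endpoint of [c], so these terms cancel mod 2. What
    remains is the parity of the number of pairs of endpoints in increasing position, which is odd
    exactly for crossing intervals. *)
Lemma unrolls_edge n (D : chord_diagram n 2) P N c c' :
  unrolls D P N ->
  inter_edge D c c' =
  crosses (fun c => minn (P (c, false)) (P (c, true)))
          (fun c => maxn (P (c, false)) (P (c, true))) c c'.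
Proof.
move=> UD; have [Pinj _ _] := UD.
rewrite /inter_edge /crosses /crossing; case: eqVneq => [<-|ncc'] /=; first by lia.
rewrite /arrow_count (card_pairs_bool (fun a b => precedes D (c, a) (c', b))).
have nP a b : P (c, a) != P (c', b).
  by rewrite (inj_eq Pinj) xpair_eqE negb_and ncc'.
have np a b : (c, a) != (c', b) by rewrite xpair_eqE negb_and ncc'.
have n1 : P (c, false) != P (c, true) by rewrite (inj_eq Pinj) xpair_eqE andbF.
have n2 : P (c', false) != P (c', true) by rewrite (inj_eq Pinj) xpair_eqE andbF.
rewrite !(unrolls_precedes UD) //.
move: n1 n2 (nP false false) (nP false true) (nP true false) (nP true true).
move: (P _) (P _) (P _) (P _) => {nP np} a a' b b' *.
rewrite !oddD !oddb.
case: (ltnP a a') => Haa; case: (ltnP b b') => Hbb;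
  rewrite ?(minn_idPl _) ?(maxn_idPr _) ?(minn_idPr _) ?(maxn_idPl _)
    ?(ltnW Haa) ?(ltnW Hbb) //; lia.
Qed.

Lemma unrolls_label n (D : chord_diagram n 2) P N c :
  unrolls D P N ->
  chord_label D c = [set half N (minn (P (c, false)) (P (c, true)));
                         half N (maxn (P (c, false)) (P (c, true)))].
Proof.
case=> _ memD _; apply/setP => i; rewrite !inE.
apply/existsP/idP => [[b]|].
  rewrite memD => /eqP <-; case: b.
    by case: leqP => _; rewrite eqxx ?orbT.
  by case: leqP => _; rewrite eqxx ?orbT.
case: leqP => _ /orP [] /eqP ->; rewrite -?memD.
- by exists false; rewrite memD.
- by exists true; rewrite memD.
- by exists true; rewrite memD.
- by exists false; rewrite memD.
Qed.

Lemma enum_I2 : enum 'I_2 = [:: ord0; ord_max].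
Proof.
rewrite enum_ordSl enum_ordSl (size0nil (size_enum_ord 0)) /=.
by congr [:: _; _]; apply: val_inj.
Qed.

Lemma exists_unrolls n (D : chord_diagram n 2) : exists P N, unrolls D P N.
Proof.
have strD := strandP D; rewrite enum_I2 /= cats0 in strD.
have Duniq : uniq (D ord0 ++ D ord_max) by rewrite (perm_uniq strD) enum_uniq.
have Dmem x : (x \in D ord0) || (x \in D ord_max).
  by rewrite -mem_cat (perm_mem strD) mem_enum.
move: Duniq; rewrite cat_uniq => /and3P [u0 /hasPn disj u1].
have D1 x : (x \in D ord_max) = ~~ (x \in D ord0).
  have := Dmem x; case x0: (x \in D ord0) => /=; last by move->.
  by move=> _; apply/negP => x1; have := disj _ x1; rewrite /= x0.
have i0 x : (index x (D ord0) < size (D ord0)) = (x \in D ord0) by rewrite index_mem.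
have i1 x : (index x (D ord_max) < size (D ord_max)) = ~~ (x \in D ord0).
  by rewrite index_mem D1.
exists (fun x => if x \in D ord0 then index x (D ord0) else
  size (D ord0) + (size (D ord_max) - (index x (D ord_max)).+1)), (size (D ord0)).
split.
- move=> x y; have := (i0 x, i0 y, i1 x, i1 y).
  case: ifP => x0; case: ifP => y0 => -[[[Ix Iy] Jx] Jy] E.
  + exact: (index_inj x x0 y0 E).
  + by move: Ix Iy E; lia.
  + by move: Ix Iy E; lia.
  + apply: (index_inj x (s := D ord_max)); rewrite ?D1 ?x0 ?y0 //.
    by move: Jx Jy E; lia.
- move=> i x; case: (ord2P i) => ->; rewrite ?D1 ?half_eq0 ?half_eq1; have := i0 x;
    by case: ifP => _; lia.
move=> i x y; case: (ord2P i) => -> /=; first by move=> -> ->.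
by rewrite !D1 => /[dup] + /negbTE -> /[dup] + /negbTE ->; rewrite -!i1; lia.
Qed.

Lemma unrollable n (P : endpoint n -> nat) N :
  injective P -> exists D : chord_diagram n 2, unrolls D P N.
Proof.
move=> Pinj.
pose lt0 x y := P x <= P y; pose lt1 x y := P y <= P x.
pose str (i : 'I_2) := sort (if i == ord0 then lt0 else lt1)
   [seq x <- enum {: endpoint n} | half N (P x) == i].
have strP : perm_eq (flatten [seq str i | i <- enum 'I_2]) (enum {: endpoint n}).
  rewrite enum_I2 /= cats0.
  apply: perm_trans (perm_cat (permEl (perm_sort _ _)) (permEl (perm_sort _ _))) _.
  rewrite [X in _ ++ X](eq_filter (a2 := predC (fun x => half N (P x) == ord0))).
    exact: permEl (perm_filterC _ _).
  by move=> x /=; rewrite half_eq0 half_eq1.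
exists (ChordDiagram strP).
have memD i x : (x \in str i) = (half N (P x) == i).
  by rewrite mem_sort mem_filter mem_enum andbT.
have uD i : uniq (str i) by rewrite sort_uniq filter_uniq // enum_uniq.
split=> // i x y /= xi yi.
have srt : sorted (if i == ord0 then lt0 else lt1) (str i).
  by apply: sort_sorted => u v; case: ifP => _; apply: leq_total.
have tr : transitive (if i == ord0 then lt0 else lt1).
  by case: ifP => _ u v w; rewrite /lt0 /lt1; lia.
have imp := sorted_ltn_index tr srt.
have xyP : index x (str i) = index y (str i) -> P x = P y.
  by move/(index_inj x xi yi) ->.
have Pxy : P x = P y -> index x (str i) = index y (str i) by move/Pinj->.
have := (imp x y xi yi, imp y x yi xi).
rewrite -!/(str i); move: (index x _) (index y _) xyP Pxy => a b.
by rewrite /lt0 /lt1; case: ifP => _ ? ? []; lia.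
Qed.

Lemma labeled_chord_rep (T : finType) (e : rel T) (lab : T -> {set 'I_2}) :
  labeled_intersection_graph e lab <-> representable e lab.
Proof.
split=> [[n [D [f [[g fK gK] fe fl]]]]|[lo [hi [N R]]]].
  have [P [N UD]] := exists_unrolls D.
  have [Pinj _ _] := UD.
  have Pf x y a b : P (f x, a) = P (f y, b) -> x = y /\ a = b.
    by move/Pinj => [/(can_inj fK) -> ->].
  have Pb x a b : a != b -> P (f x, a) != P (f x, b).
    by apply: contra => /eqP /Pf [_ ->].
  exists (fun x => minn (P (f x, false)) (P (f x, true))),
         (fun x => maxn (P (f x, false)) (P (f x, true))), N; split.
  - by move=> x /=; have := Pb x false true isT; move: (P _) (P _) => a b; lia.
  - by move=> x y; case: leqP => _; case: leqP => _ /Pf [].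
  - by move=> x y; case: leqP => _; case: leqP => _ /Pf [].
  - move=> x y /= E; have xy : x = y.
      by move: E; case: leqP => _; case: leqP => _ /Pf [].
    have := Pb x false true isT; move: E; rewrite -xy.
    by move: (P _) (P _) => a b; lia.
  - by move=> x y; rewrite -fe (unrolls_edge _ _ UD).
  - by move=> x; rewrite -fl (unrolls_label _ UD).
case: R => lt_lohi loI hiI lohi eE lE.
(* The endpoint named [false] goes to the left end of the interval, the one named [true] to the
   right end. *)
pose P (z : endpoint #|T|) := (if z.2 then hi else lo) (enum_val z.1).
have Pinj : injective P.
  move=> [c b] [c' b']; rewrite /P; case: b; case: b' => /= E.
  - by rewrite (enum_val_inj (hiI _ _ E)).
  - by case: (lohi _ _ (esym E)).
  - by case: (lohi _ _ E).
  - by rewrite (enum_val_inj (loI _ _ E)).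
have [D UD] := unrollable N Pinj.
have PE x : (P (enum_rank x, false) = lo x) * (P (enum_rank x, true) = hi x).
  by rewrite /P /= enum_rankK.
exists #|T|, D, enum_rank; split.
- exact: enum_rank_bij.
- move=> x y; rewrite (unrolls_edge _ _ UD) eE /crosses /crossing !PE.
  by rewrite !(minn_idPl _) ?(maxn_idPr _) // ltnW.
- move=> x; rewrite (unrolls_label _ UD) lE !PE.
  by rewrite (minn_idPl _) ?(maxn_idPr _) // ltnW.
Qed.

(** * Crossings with a marked interval *)

Lemma crossingC a a' b b' : crossing a a' b b' = crossing b b' a a'.
Proof. by rewrite /crossing orbC. Qed.

(** An interval that misses the cut stays on one side of it, so it crosses a marked interval by
    containing the end of the latter on that side. *)
Lemma crossing_unmarked N a a' b b' : a < a' -> b < b' ->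
  crossing a a' b b' -> (a < N <= a') = false -> b < N <= b' ->
  if N <= a then (b < a < b') && (b' < a') else (a < b < a') && (a' < N).
Proof. by rewrite /crossing; case: ifP; lia. Qed.

(* The four lemmas below compare the components of the two edges at a marked
   vertex of a path: [a], [b], [c] are three consecutive vertices, the letters
   [m] and [u] tell which of them are marked, and [D] is the global direction
   of the path ([d] in section [Path]). *)
Lemma turn_mmm N a a' b b' c c' D :
  crossing a a' b b' -> crossing b b' c c' -> ~~ crossing a a' c c' ->
  a < N <= a' -> b < N <= b' -> c < N <= c' -> (c < a < c') = D ->
  ((a < b) (+) D) (+) ((b < c) (+) D) = true.
Proof.
rewrite /crossing => e1 e2 ne ma mb mc <-; clear D.
have -> s t u : (s (+) u) (+) (t (+) u) = (s (+) t).
  by case: s; case: t; case: u.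
by case: (ltngtP a b) e1 => //= ab e1; case: (ltngtP b c) e2 => //= bc e2; lia.
Qed.

Lemma turn_umm N a a' b b' c c' D : a < a' -> b < b' ->
  crossing a a' b b' -> crossing b b' c c' -> ~~ crossing a a' c c' ->
  (a < N <= a') = false -> b < N <= b' -> c < N <= c' -> (c < a < c') = D ->
  a != c -> c != a' -> (N <= a) (+) ((b < c) (+) D) = true.
Proof.
move=> A B e1 e2 ne ma mb mc; have {e1 ma} := crossing_unmarked A B e1 ma mb.
rewrite /crossing in e2 ne; clear A B.
by case: ifP; case: D; case: (ltngtP b c) e2 => //= ? ? ? ?; lia.
Qed.

Lemma turn_mmu N a a' b b' c c' D : b < b' -> c < c' ->
  crossing a a' b b' -> crossing b b' c c' -> ~~ crossing a a' c c' ->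
  a < N <= a' -> b < N <= b' -> (c < N <= c') = false ->
  (a < c < a') = ~~ D -> a != c -> a != c' ->
  ((a < b) (+) D) (+) (N <= c) = true.
Proof.
move=> B C; rewrite (crossingC b) => e1 e2 ne ma mb mc.
have {e2 mc} := crossing_unmarked C B e2 mc mb.
rewrite /crossing in e1 ne; clear B C.
by case: ifP; case: D; case: (ltngtP a b) e1 => //= ? ? ? ?; lia.
Qed.

Lemma turn_umu N a a' b b' c c' : a < a' -> b < b' -> c < c' ->
  crossing a a' b b' -> crossing b b' c c' ->
  (a < N <= a') = false -> b < N <= b' -> (c < N <= c') = false ->
  (c < a < c') = false -> (a < c < a') = false -> a != c -> c != a' ->
  (N <= a) (+) (N <= c) = true.
Proof.
move=> A B C; rewrite (crossingC b) => e1 e2 ma mb mc.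
have {e2 mc} := crossing_unmarked C B e2 mc mb.
have {e1 ma} := crossing_unmarked A B e1 ma mb.
by clear; do 2 (case: ifP => ? ?); lia.
Qed.

Lemma is_mark_half N i j : is_mark [set half N i; half N j] = ((i < N) (+) (j < N)).
Proof.
rewrite /is_mark /half; case: (i < N); case: (j < N) => /=.
- by apply/negbTE/eqP => /setP /(_ ord_max); rewrite !inE.
- exact: eqxx.
- by rewrite setUC eqxx.
- by apply/negbTE/eqP => /setP /(_ ord0); rewrite !inE.
Qed.

Lemma set_half_eq N i N' j :
  ([set half N i] == [set half N' j]) = ((i < N) == (j < N')).
Proof.
by rewrite (inj_eq set1_inj) /half; case: (i < N); case: (j < N').
Qed.

(** * Marked paths in an interval representation *)

Section ChordRep.

Variables (T : finType) (e : rel T) (lab : T -> {set 'I_2}).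
Variables (lo hi : T -> nat) (N : nat).
Hypothesis R : chord_rep e lab lo hi N.

Let mk := marked lab.

Lemma rep_marked x : mk x = (lo x < N <= hi x).
Proof.
rewrite /mk /marked (rep_lab R) is_mark_half.
by have := rep_lt R x; lia.
Qed.

Lemma rep_unmarked x : ~~ mk x -> lab x = [set half N (lo x)].
Proof.
move=> mx; rewrite (rep_lab R) -[RHS]setUid /half.
have -> // : (hi x < N) = (lo x < N).
by have := rep_lt R x; move: mx; rewrite rep_marked; lia.
Qed.

Lemma rep_unmarked_eq x y :
  ~~ mk x -> ~~ mk y -> (lab x == lab y) = ((lo x < N) == (lo y < N)).
Proof.
by move=> mx my; rewrite !rep_unmarked // set_half_eq.
Qed.

Lemma rep_unmarked_edge x y : e x y -> ~~ mk x -> ~~ mk y -> lab x = lab y.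
Proof.
move=> exy mx my; apply/eqP; rewrite rep_unmarked_eq //.
move: exy mx my; rewrite (rep_edge R) !rep_marked /crosses /crossing.
by move: (rep_lt R x) (rep_lt R y); lia.
Qed.

(** Testing the left end is enough: when [x] and [a] are distinct and do not cross, this says that
    the whole interval of [x] is nested in that of [a]. *)
Definition under (a x : T) : bool := lo a < lo x < hi a.

Lemma rep_distinct x y : x != y ->
  [/\ lo x != lo y, hi x != hi y, lo x != hi y & lo y != hi x].
Proof.
move=> nxy; split; try by apply/eqP; apply: (rep_neq R).
  by rewrite (inj_eq (rep_lo_inj R)).
by rewrite (inj_eq (rep_hi_inj R)).
Qed.

Definition apart (a x : T) : bool := (x != a) && ~~ e a x.

Lemma rep_sym : symmetric e.
Proof. by move=> x y; rewrite !(rep_edge R) /crosses /crossing orbC. Qed.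

Lemma apartC a x : apart a x = apart x a.
Proof. by rewrite /apart eq_sym rep_sym. Qed.

(** An interval nested in [a] cannot cross one that lies outside [a] or encloses it. *)
Lemma under_edge a x y : apart a x -> apart a y -> e x y -> under a x = under a y.
Proof.
case/andP => xa + /andP [ya]; rewrite !(rep_edge R) /crosses /crossing /under.
case: (rep_distinct xa) => *; case: (rep_distinct ya) => *.
by move: (rep_lt R x) (rep_lt R y) (rep_lt R a); lia.
Qed.

Lemma under_path a x p : path e x p -> all (apart a) (x :: p) ->
  under a (last x p) = under a x.
Proof.
elim: p x => //= y p IH x /andP [exy pyp] /and3P [ax ay al].
by rewrite (IH _ pyp) ?(under_edge ax ay exy) //= ay.
Qed.

(** Both intervals contain the cut, so they are not disjoint; if they do not cross, exactly one is
    nested in the other. *)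
Lemma under_marked a b : mk a -> mk b -> apart a b -> under a b = ~~ under b a.
Proof.
move=> ma mb /andP [ba]; move: ma mb.
rewrite !rep_marked (rep_edge R) /crosses /crossing /under.
case: (rep_distinct ba) => *.
by move: (rep_lt R a) (rep_lt R b); lia.
Qed.

Lemma under_marked_unmarked a b : mk a -> ~~ mk b -> apart a b -> under b a = false.
Proof.
move=> ma mb /andP [_]; move: ma mb.
rewrite !rep_marked (rep_edge R) /crosses /crossing /under.
by move: (rep_lt R a) (rep_lt R b); lia.
Qed.

Section Path.
Variables (p : nat -> T) (n : nat).
Hypothesis edge_p : forall i, i < n -> e (p i) (p i.+1).
Hypothesis far_p : forall i j, i.+1 < j -> j <= n -> apart (p i) (p j).
Hypotheses (mk0 : mk (p 0)) (mkn : mk (p n)).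

Lemma far_pC i j : i.+1 < j -> j <= n -> apart (p j) (p i).
Proof. by rewrite apartC; apply: far_p. Qed.

Let d := under (p n) (p 0).

Lemma under_prefix j i : i.+1 < j -> j <= n -> under (p j) (p i) = under (p j) (p 0).
Proof.
move=> + jn; elim: i => // i IH ij; rewrite -(IH (ltnW ij)).
apply/esym/under_edge; [exact: far_pC (ltnW ij) jn | exact: far_pC ij jn | ].
by apply: edge_p; lia.
Qed.

Lemma under_suffix j i : j.+1 < i -> i <= n -> under (p j) (p i) = under (p j) (p n).
Proof.
move=> ji i_n; rewrite -(subKn i_n).
have : j.+1 < n - (n - i) by rewrite subKn.
elim: (n - i) => [|k IH] ji'; first by rewrite subn0.
have E : n - k = (n - k.+1).+1 by lia.
have ji2 : j.+1 < n - k by rewrite E ltnW.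
rewrite -(IH ji2); apply/under_edge.
- exact: far_p ji' (leq_subr _ _).
- exact: far_p ji2 (leq_subr _ _).
by rewrite E; apply: edge_p; lia.
Qed.

(** Sliding [i] down to [0], exchanging the roles of the two marked intervals, sliding [j] up to [n]
    and exchanging again turns the left-hand side into [d]. *)
Lemma under_before j i : mk (p j) -> i.+1 < j -> j <= n -> under (p j) (p i) = d.
Proof.
move=> mj ij jn; rewrite (under_prefix ij jn).
have far0j : 1 < j by lia.
have far0n : 1 < n by lia.
rewrite under_marked ?(far_pC far0j) // (under_suffix far0j jn).
by rewrite under_marked ?(far_p far0n) // negbK.
Qed.

Lemma under_after j i : mk (p j) -> j.+1 < i -> i <= n -> under (p j) (p i) = ~~ d.
Proof.
move=> mj ji i_n; rewrite (under_suffix ji i_n).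
have far : j.+1 < n by lia.
by rewrite under_marked ?(far_p far) // (under_prefix far).
Qed.

(* [true] when the edge from [p k] to [p k.+1] takes place on the second
   component.  Two crossing marked chords meet on both components: the edge is
   assigned to the one where their order opposes the global direction [d]. *)
Definition edge_comp k :=
  if ~~ mk (p k) then N <= lo (p k)
  else if ~~ mk (p k.+1) then N <= lo (p k.+1)
  else (lo (p k) < lo (p k.+1)) (+) d.

Lemma edge_comp_step k : k.+1 < n ->
  edge_comp k (+) edge_comp k.+1 = mk (p k.+1).
Proof.
move=> kn.
have e1 : e (p k) (p k.+1) by apply: edge_p; lia.
have e2 : e (p k.+1) (p k.+2) by apply: edge_p; lia.
have far := far_p (ltnSn k.+1) kn.
(* These four facts settle how [p k] and [p k.+2] are nested. A marked one obeys the global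
   direction; an unmarked one does not enclose the other, since it would then enclose a marked end
   of the path too. *)
have U1 : mk (p k.+2) -> under (p k.+2) (p k) = d.
  by move=> H; apply: under_before.
have U2 : mk (p k) -> under (p k) (p k.+2) = ~~ d.
  by move=> H; apply: under_after.
have U3 : ~~ mk (p k.+2) -> under (p k.+2) (p k) = false.
  by move=> H; rewrite (under_prefix (ltnSn k.+1) kn) under_marked_unmarked ?far_p.
have U4 : ~~ mk (p k) -> under (p k) (p k.+2) = false.
  by move=> H; rewrite (under_suffix (ltnSn k.+1) kn) under_marked_unmarked ?far_pC.
have [[lt0 lt1] lt2] := (rep_lt R (p k), rep_lt R (p k.+1), rep_lt R (p k.+2)).
have unm x : mk x = false -> (lo x < N <= hi x) = false by rewrite rep_marked.
have mar x : mk x -> lo x < N <= hi x by rewrite rep_marked.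
case/andP: far; rewrite eq_sym => nx ne; case: (rep_distinct nx) => n1 n2 n3 n4.
rewrite !(rep_edge R) in e1 e2 ne; rewrite /edge_comp /under in U1 U2 U3 U4 *.
case my: (mk (p k.+1)) => /=; last first.
  case mx: (mk (p k)); first by rewrite addbb.
  move: e1 (unm _ mx) (unm _ my) lt0 lt1; rewrite /crosses /crossing.
  move: (lo (p k)) (lo (p k.+1)) (hi (p k)) (hi (p k.+1)) => a b a' b'.
  by clear; rewrite /=; lia.
case mx: (mk (p k)); case mz: (mk (p k.+2)) => /=.
- exact: turn_mmm e1 e2 ne (mar _ mx) (mar _ my) (mar _ mz) (U1 mz).
- exact: turn_mmu lt1 lt2 e1 e2 ne (mar _ mx) (mar _ my) (unm _ mz) (U2 mx) n1 n3.
- exact: turn_umm lt0 lt1 e1 e2 ne (unm _ mx) (mar _ my) (mar _ mz) (U1 mz) n1 n4.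
- apply: (turn_umu lt0 lt1 lt2 e1 e2 (unm _ mx) (mar _ my) (unm _ mz)) => //.
  + by rewrite U3 ?mz.
  + by rewrite U4 ?mx.
Qed.

Lemma edge_comp_sum i j : i < n -> j < n -> i <= j ->
  edge_comp i (+) edge_comp j = odd (\sum_(i.+1 <= k < j.+1) mk (p k)).
Proof.
move=> i_n + ij; elim: j ij => [|j IH].
  by rewrite leqn0 => /eqP -> _; rewrite addbb big_geq.
rewrite leq_eqVlt => /predU1P [-> _ | ij jn]; first by rewrite addbb big_geq.
rewrite big_nat_recr //= oddD oddb -(IH _ (ltnW jn)) // -(edge_comp_step jn).
by rewrite addbA addbK.
Qed.

(** The edge leaving an unmarked vertex takes place on the component of that vertex, so the
    telescoped changes of component compare the two labels. *)
Lemma path_parity i j : i <= j -> j < n -> ~~ mk (p i) -> ~~ mk (p j) ->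
  (lab (p i) == lab (p j)) = ~~ odd (\sum_(i.+1 <= k < j) mk (p k)).
Proof.
move=> ij jn mi mj; rewrite rep_unmarked_eq // !ltnNge.
have := edge_comp_sum (leq_ltn_trans ij jn) jn ij; rewrite /edge_comp mi mj.
have -> : \sum_(i.+1 <= k < j.+1) mk (p k) = \sum_(i.+1 <= k < j) mk (p k).
  have [ji|lt_ij] := leqP j i.
    by rewrite (eqP (_ : j == i)) ?eqn_leq ?ij ?ji // !big_geq.
  by rewrite big_nat_recr //= (negbTE mj) addn0.
by move<-; case: (N <= _); case: (N <= _).
Qed.

End Path.
End ChordRep.

(** * Changing the labels of a representation *)

Lemma lex_eq K a r b s : r < K -> s < K ->
  (a * K + r == b * K + s) = (a == b) && (r == s).
Proof.
move=> rK sK; apply/eqP/andP => [E|[/eqP-> /eqP->] //].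
have K0 : 0 < K by lia.
have := congr1 (divn^~ K) E; have := congr1 (modn^~ K) E.
by rewrite !modnMDl !divnMDl // !modn_small // !divn_small // !addn0 => -> ->.
Qed.

Lemma lex_ltn K a r b s : r < K -> s < K ->
  (a * K + r < b * K + s) = (a < b) || (a == b) && (r < s).
Proof.
move=> rK sK; case: (ltngtP a b) => [ab|ba|->] /=.
- by have : a.+1 * K <= b * K by [rewrite leq_mul2r ab orbT]; rewrite mulSn; lia.
- by have : b.+1 * K <= a * K by [rewrite leq_mul2r ba orbT]; rewrite mulSn; lia.
- by rewrite ltn_add2l.
Qed.

Section Moves.

Variables (T : finType) (e : rel T) (lab : T -> {set 'I_2}).
Hypothesis repr : representable e lab.

(** Reflecting the line preserves crossings and exchanges the two sides of the cut. *)
Lemma swap_components : exists lab',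
  [/\ representable e lab', marked lab' =1 marked lab
    & forall x, ~~ marked lab x -> lab' x != lab x].
Proof.
have [lo [hi [N R]]] := repr.
pose M := N + \max_x hi x.
have hiM x : hi x <= M by apply: leq_trans (leq_bigmax x) (leq_addl _ _).
have loM x : lo x <= M by apply: leq_trans (ltnW (rep_lt R x)) (hiM x).
(* With this offset, [M - i] falls left of the new cut exactly when [N <= i]. *)
pose N' := M.+1 - N.
pose lab' x := [set half N' (M - hi x); half N' (M - lo x)].
have R' : chord_rep e lab' (fun x => M - hi x) (fun x => M - lo x) N'.
  split=> //.
  - by move=> x; move: (rep_lt R x) (hiM x); lia.
  - by move=> x y /= E; apply: (rep_hi_inj R); move: (hiM x) (hiM y); lia.
  - by move=> x y /= E; apply: (rep_lo_inj R); move: (loM x) (loM y); lia.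
  - by move=> x y /= E; apply: (@rep_neq _ _ _ _ _ _ R y x); move: (hiM x) (loM y); lia.
  - move=> x y; rewrite (rep_edge R) /crosses /crossing /=.
    by move: (hiM x) (loM x) (hiM y) (loM y); lia.
have NM : N <= M by apply: leq_addr.
have mE : marked lab' =1 marked lab.
  move=> x; rewrite (rep_marked R) (rep_marked R').
  by move: (hiM x) (loM x); lia.
exists lab'; split=> //; first by exists (fun x => M - hi x), (fun x => M - lo x), N'.
move=> x mx; rewrite (rep_unmarked R') ?mE // (rep_unmarked R mx) set_half_eq.
by move: mx; rewrite (rep_marked R); move: (rep_lt R x) (hiM x) (loM x); lia.
Qed.

Variables (B : {set T}) (m : T).
Hypotheses (markm : marked lab m) (unmB : {in B, forall x, ~~ marked lab x})
  (sameB : {in B &, forall x y, lab x = lab y})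
  (outB : forall x y, x \in B -> y \notin B -> e x y -> y = m).

(* The block [B] is read backwards around the other endpoint of [m]: that is
   how the same block looks when carried to the other component, since the
   second component is laid out in reverse.  Positions are encoded
   lexicographically, to make room for the block next to that endpoint. *)
Lemma flip_block : exists lab',
  [/\ representable e lab', marked lab' =1 marked lab,
      {in B, forall x, lab' x != lab x}
    & forall x, x \notin B -> lab' x = lab x].
Proof.
have [lo [hi [N R]]] := repr.
have [->|/set0Pn [b0 b0B]] := eqVneq B set0.
  by exists lab; split=> // x; rewrite inE.
pose M := (\max_x hi x).+1.
have hiM x : hi x < M by rewrite ltnS; apply: leq_bigmax.
have loM x : lo x < M by apply: ltn_trans (rep_lt R x) (hiM x).
(* [p] is the end of [m] on the component of the block, [q] its end on the other component. *)
pose p := if lo b0 < N then lo m else hi m.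
pose q := if lo b0 < N then hi m else lo m.
have pM : p < M by rewrite /p; case: ifP.
have mm : lo m < N <= hi m by rewrite -(rep_marked R).
have sB x : x \in B -> (lo x < N) = (lo b0 < N) /\ (hi x < N) = (lo b0 < N).
  move=> xB; have /eqP := sameB xB b0B.
  rewrite (rep_unmarked_eq R) ?unmB // => /eqP <-; split=> //.
  by have := unmB xB; rewrite (rep_marked R); have := rep_lt R x; lia.
have mB : m \notin B by apply/negP => /unmB; rewrite markm.
pose K := M + M.
(* The leading digit sends the whole block to [q]. The second digit reflects the block so that [p]
   would land on [M], the second digit of every other point and in particular of [q]. *)
pose A (f : T -> nat) x := if x \in B then q else f x.
pose r (f : T -> nat) x := if x \in B then M + p - f x else M.
have rK f x : (forall y, f y < M) -> r f x < K.
  by move=> fM; rewrite /r; case: ifP => _; have := fM x; lia.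
(* The reflection exchanges the two ends of each block interval, hence [r hi] in [lo'] and [r lo] in
   [hi']. *)
pose lo' x := A lo x * K + r hi x.
pose hi' x := A hi x * K + r lo x.
pose lab' x := [set half (N * K) (lo' x); half (N * K) (hi' x)].
have qN : (q < N) = ~~ (lo b0 < N) by rewrite /q; case: ifP mm; lia.
have pB x : x \in B -> p != lo x /\ p != hi x.
  move=> xB; have mx : m != x by apply: contraNneq mB => ->.
  case: (rep_distinct R mx) => n1 n2 n3 n4; rewrite /p; case: ifP => _ //.
  by rewrite eq_sym n4.
have qB y : y != m -> q != lo y /\ q != hi y.
  rewrite eq_sym => my; case: (rep_distinct R my) => n1 n2 n3 n4.
  by rewrite /q; case: ifP => _ //; rewrite eq_sym n4.
have A_r x y f g f' g' :
    (forall y, f y < M) -> (forall y, g y < M) ->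
    (x \in B -> p != f x) -> (y \in B -> p != g y) ->
    A f' x * K + r f x = A g' y * K + r g y ->
    f x = g y /\ x \in B /\ y \in B \/ f' x = g' y.
  move=> fM gM fp gp /eqP; rewrite lex_eq ?rK // /A /r => /andP [].
  move: (fM x) (gM y).
  case: ifP => xB; case: ifP => yB; last by move=> _ _ /eqP ->; right.
  - by move=> *; left; split=> //; lia.
  - by have := fp xB; lia.
  - by have := gp yB; lia.
have crossB x y : x \in B -> y \in B = false ->
  crossing (lo x) (hi x) (lo y) (hi y) =
  (((q < lo y) || (q == lo y) && (M + p - hi x < M)) &&
      ((lo y < q) || (lo y == q) && (M < M + p - lo x)))
    && ((q < hi y) || (q == hi y) && (M + p - lo x < M))
  || (((lo y < q) || (lo y == q) && (M < M + p - hi x)) &&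
         ((q < hi y) || (q == hi y) && (M + p - hi x < M)))
       && ((hi y < q) || (hi y == q) && (M < M + p - lo x)).
  (* The right-hand side is the crossing test on the new positions. For [y] other than [m] both
     sides are false: there was no edge, and the block now sits at [q], which is no end of [y]. For
     [m], a block interval contains [q] after the move exactly when it contained [p] before. *)
  move=> xB yB; have [ym|ym] := eqVneq y m; last first.
    have -> : crossing (lo x) (hi x) (lo y) (hi y) = false.
      apply: contraNF ym => xy; apply/eqP/(outB xB); first by rewrite yB.
      by rewrite (rep_edge R).
    by case: (qB _ ym) => *; lia.
  rewrite ym; case: (pB x xB); case: (sB x xB).
  move: (hiM x) (loM x) (rep_lt R x) (rep_lt R m) mm; rewrite /p /q.
  move: (lo x) (hi x) (lo m) (hi m) (lo b0) => a a' c c' b; clear; rewrite /crossing.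
  by case: ifP => ? *; lia.
have R' : chord_rep e lab' lo' hi' (N * K).
  split=> //.
  - move=> x; rewrite lex_ltn ?rK //; rewrite /A /r; case: ifP => xB.
      by move: (rep_lt R x) (hiM x) pM; lia.
    by rewrite (rep_lt R).
  - move=> x y /A_r [] //; try by move=> /pB [].
      by case=> /(rep_hi_inj R).
    exact: (rep_lo_inj R).
  - move=> x y /A_r [] //; try by move=> /pB [].
      by case=> /(rep_lo_inj R).
    exact: (rep_hi_inj R).
  - move=> x y /A_r [] //; try by move=> /pB [].
      by case=> /esym /(rep_neq R).
    by move=> /(rep_neq R).
  - move=> x y; rewrite (rep_edge R) /crosses /crossing /lo' /hi' !lex_ltn ?rK //.
    rewrite /A /r.
    case xB: (x \in B); case yB: (y \in B) => /=.
    + rewrite ltnn eqxx /=.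
      move: (hiM x) (hiM y) (loM x) (loM y) (rep_lt R x) (rep_lt R y) pM.
      clear; move: (lo x) (hi x) (lo y) (hi y) => a a' b b'; lia.
    + exact: crossB.
    + by rewrite orbC [RHS]orbC; apply: crossB.
    + by rewrite ltnn !andbF !orbF.
have E0 x : ((lo' x < N * K) = if x \in B then ~~ (lo x < N) else lo x < N) /\
            ((hi' x < N * K) = if x \in B then ~~ (hi x < N) else hi x < N).
  have K0 : 0 < K by lia.
  rewrite -[N * K]addn0 !lex_ltn ?rK // !ltn0 !andbF !orbF /A.
  by case: ifP => // /sB [-> ->].
have mE : marked lab' =1 marked lab.
  move=> x; rewrite (rep_marked R) (rep_marked R') [_ <= hi' x]leqNgt.
  have [-> ->] := E0 x; rewrite [_ <= hi x]leqNgt; case: ifP => // /sB [-> ->].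
  by case: (lo b0 < N).
exists lab'; split=> //.
- by exists lo', hi', (N * K).
- move=> x xB; rewrite (rep_unmarked R') ?mE ?unmB // (rep_unmarked R (unmB xB)).
  by rewrite set_half_eq (E0 x).1 xB; case: (lo x < N).
- move=> x xB; rewrite (rep_lab R) /lab'; have := E0 x; rewrite (negbTE xB) => -[].
  by rewrite /half => -> ->.
Qed.

End Moves.

(** * Trees *)

Lemma sorted_connect (T : finType) (r : rel T) s x y :
  symmetric r -> sorted r s -> x \in s -> y \in s -> connect r x y.
Proof.
move=> rsym; case: s => // z s pz xs ys.
apply: (connect_trans (y := z)); last exact: (path_connect pz ys).
rewrite (sym_connect_sym rsym).
exact: (path_connect pz xs).
Qed.

Section Tree.

Variables (T : finType) (e : rel T).
Hypothesis treeT : is_tree e.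

Lemma tree_sym : symmetric e. Proof. by case: treeT => _ []. Qed.

Lemma tree_irr : irreflexive e. Proof. by case: treeT => _ []. Qed.

Lemma tree_connect x y : connect e x y. Proof. by case: treeT. Qed.

Definition off (x : T) : rel T := [rel a b | [&& e a b, a != x & b != x]].

Lemma off_sym x : symmetric (off x).
Proof. by move=> a b; rewrite /off /= tree_sym [(a != x) && _]andbC. Qed.

Lemma off_path x y q : path (off x) y q -> path e y q && (x \notin q).
Proof.
elim: q y => //= z q IH y /andP [/and3P [-> _ zx] /IH /andP [-> xq]].
by rewrite inE negb_or eq_sym zx xq.
Qed.

Lemma path_off x y q : path e y q -> x \notin y :: q -> path (off x) y q.
Proof.
move=> pq xq; have al : all (predC1 x) (y :: q).
  by apply/allP => a aq; apply: contraNneq xq => <-.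
apply: (sub_in_path (P := predC1 x)) al pq.
by move=> a b; rewrite !inE /off /= => -> -> ->.
Qed.

(** Distinct neighbors of [x] joined by a simple path avoiding [x] would close a cycle through
    [x]. *)
Lemma tree_neighbors x u v : e x u -> e x v -> connect (off x) u v -> u = v.
Proof.
move=> xu xv /connectP [p pp ev]; rewrite ev in xv *.
case/shortenP: pp xv => {ev}p' /off_path; case: p' => //= w p' pp' up' _ xl.
have [_ _ _ /(_ [:: x, u, w & p'])] := treeT; case=> //.
case/andP: pp' => pp' xp'; apply/andP; split=> /=.
  by move: pp' => /= /andP [-> pp']; rewrite xu rcons_path pp' tree_sym.
rewrite up' andbT inE negb_or xp' andbT.
by apply: contraTneq xu => ->; rewrite tree_irr.
Qed.

(** The first steps of both paths are neighbors of [x] joined away from [x] by the remaining steps,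
    so they coincide; induction does the rest. *)
Lemma tree_path_unique x p q : path e x p -> path e x q -> uniq (x :: p) ->
  uniq (x :: q) -> last x p = last x q -> p = q.
Proof.
elim: p x q => [|u p IH] x [|v q] //=.
- by move=> _ _ _ /andP [+ _] E; rewrite {1}E mem_last.
- by move=> _ _ /andP [+ _] _ E; rewrite -{1}E mem_last.
move=> /andP [xu pp] /andP [xv pq] /andP [xp up] /andP [xq uq] E.
have uv : u = v.
  apply: (tree_neighbors xu xv); apply: (@connect_trans _ _ (last u p)).
    by apply/connectP; exists p => //; apply: path_off.
  rewrite (sym_connect_sym (@off_sym x)) E.
  by apply/connectP; exists q => //; apply: path_off.
by rewrite -uv in pq uq E *; rewrite (IH u q).
Qed.

(** Both connections shorten to the same simple path, whose edges therefore belong to both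
    relations. *)
Lemma tree_connectI (r r' : rel T) x y : subrel r e -> subrel r' e ->
  connect r x y -> connect r' x y -> connect [rel a b | r a b && r' a b] x y.
Proof.
move=> re r'e /connectP [p pp ->] /connectP [q pq].
case/shortenP: pp => {}p pp up _; case/shortenP: pq => {}q pq uq _ E.
have pE : p = q by apply: tree_path_unique (sub_path re pp) (sub_path r'e pq) up uq E.
apply/connectP; exists p => //.
rewrite -pE in pq; elim: p x pp pq {up uq E pE} => //= z p IH x.
by move=> /andP [-> /IH {}IH] /andP [-> /IH].
Qed.

(** Simple paths of a tree are induced: an edge from entry [i] to entry [j] would make entries
    [i.+1] and [j] two neighbors of entry [i] joined along [s] without it. *)
Lemma tree_sorted_far z s i j : sorted e s -> uniq s -> i.+1 < j -> j < size s ->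
  (nth z s j != nth z s i) && ~~ e (nth z s i) (nth z s j).
Proof.
move=> /(sortedP z) ss us ij js.
have nq k l : k < l -> l < size s -> nth z s l != nth z s k.
  by move=> kl ls; rewrite nth_uniq ?(ltn_trans kl ls) // neq_ltn kl orbT.
rewrite nq ?(ltnW ij) //=; apply/negP => eij.
have i1 := ltn_trans ij js.
have := nq _ _ ij js; rewrite eq_sym => /eqP; apply.
apply: (tree_neighbors (ss i i1) eij).
elim: j ij js {eij} => // j IH; rewrite ltnS leq_eqVlt => /predU1P [<- | ij] js.
  by apply: connect1; rewrite /off /= ss // !nq.
apply: connect_trans (IH ij (ltnW js)) _.
by apply: connect1; rewrite /off /= ss // !nq // ?(ltnW ij) // ltnW // ltnW.
Qed.

End Tree.

(** * Parity along marked paths of a tree *)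

Lemma count_slice (T : Type) (a : pred T) z s i j : j <= size s ->
  count a (drop i (take j s)) = \sum_(i <= k < j) a (nth z s k).
Proof.
elim: j => [|j IH] js; first by rewrite take0 big_geq.
have [ji|ij] := ltnP j i.
  by rewrite drop_oversize ?big_geq // size_take_min geq_min ji.
rewrite (take_nth z) // drop_rcons ?size_takel ?(ltnW js) //.
by rewrite -cats1 count_cat IH ?(ltnW js) // big_nat_recr //= addn0.
Qed.

Lemma marked_pathE (T : finType) (e : rel T) (m : pred T) z s : marked_path e m s ->
  [/\ 0 < size s, sorted e s, uniq s, m (nth z s 0) & m (nth z s (size s).-1)].
Proof.
by case: s => // x p /and4P [pp up mx ml]; rewrite nth_last.
Qed.

Lemma marked_pathI (T : finType) (e : rel T) (m : pred T) z s : 0 < size s ->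
  sorted e s -> uniq s -> m (nth z s 0) -> m (nth z s (size s).-1) -> marked_path e m s.
Proof.
by rewrite nth_last; case: s => // x p _ /= -> -> -> ->.
Qed.

Section Between.

Variables (T : finType) (e : rel T) (lab : T -> {set 'I_2}).
Variables (lo hi : T -> nat) (N : nat).
Hypotheses (treeT : is_tree e) (R : chord_rep e lab lo hi N).

Let mk := marked lab.

Lemma between_parity S v w : marked_path e mk S -> v \in S -> w \in S ->
  ~~ mk v -> ~~ mk w -> (lab v == lab w) = ~~ odd (count mk (between S v w)).
Proof.
move=> mS; wlog vw : v w / index v S <= index w S.
  move=> H vS wS mv mw; have [|/ltnW] := leqP (index v S) (index w S).
    by move=> vw; apply: H.
  by move=> wv; rewrite eq_sym H // /between minnC maxnC.
move=> vS wS mv mw; have [S0 sS uS m0 mn] := marked_pathE v mS.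
rewrite /between (minn_idPl vw) (maxn_idPr vw).
rewrite (count_slice mk v) ?index_size //.
(* The last vertex is marked and [w] is not, so an edge of the path leaves [w], as [path_parity]
   requires. *)
have wn : index w S < (size S).-1.
  have : index w S < size S by rewrite index_mem.
  have : index w S != (size S).-1.
    by apply: contraNneq mw => E; rewrite -(nth_index v wS) E.
  by lia.
rewrite -{1}(nth_index v vS) -{1}(nth_index v wS).
apply: (path_parity R (p := nth v S) (n := (size S).-1)) => //.
- by move=> i; rewrite ltn_predRL; apply: (sortedP v sS).
- move=> i j ij jn; apply: tree_sorted_far => //.
  by apply: (leq_ltn_trans jn); rewrite ltn_predL.
- by rewrite nth_index.
- by rewrite nth_index.
Qed.

End Between.

(** * Marked vertices are close to the spine *)

Definition longest_marked_path (T : finType) (e : rel T) (m : pred T)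
    (s : seq T) : Prop :=
  marked_path e m s /\ forall s', marked_path e m s' -> size s' <= size s.

Lemma marked_path_rev (T : finType) (e : rel T) (m : pred T) s :
  symmetric e -> marked_path e m s -> marked_path e m (rev s).
Proof.
move=> esym; case: s => // z s /(marked_pathE z) [s0 ss us m0 mn].
apply: (marked_pathI (z := z)); rewrite ?size_rev ?rev_uniq ?nth_rev ?subn1 //.
  by rewrite rev_sorted (eq_sorted (e' := e)) // => x y; rewrite esym.
by rewrite subnn.
Qed.

Lemma longest_marked_path_rev (T : finType) (e : rel T) (m : pred T) s :
  symmetric e -> longest_marked_path e m s -> longest_marked_path e m (rev s).
Proof.
move=> esym [ms maxs]; rewrite /longest_marked_path size_rev.
by split=> //; apply: marked_path_rev.
Qed.

Section NearSpine.

Variables (T : finType) (e : rel T) (lab : T -> {set 'I_2}).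
Variables (lo hi : T -> nat) (N : nat).
Hypotheses (treeT : is_tree e) (R : chord_rep e lab lo hi N).

Let mk := marked lab.
Let esym := tree_sym treeT.

Definition near (S : seq T) : pred T := fun u => has (fun s => (u == s) || e u s) S.

Lemma not_near_apart S u s : ~~ near S u -> s \in S -> apart e s u.
Proof.
move=> /hasPn H sS; have := H s sS; rewrite negb_or /apart => /andP [-> /=].
by rewrite esym.
Qed.

(** The path from [m] to the spine meets it at a vertex [x] which, by maximality, is at least two
    steps from the first vertex [a]. Going from [m] to [x] and on to the last vertex of [S] thus
    avoids the closed neighborhood of [a]. *)
Lemma under_first_last z0 S m :
  longest_marked_path e mk S -> mk m -> ~~ near S m ->
  apart e (nth z0 S 0) (nth z0 S (size S).-1) /\
  under lo hi (nth z0 S 0) m = under lo hi (nth z0 S 0) (nth z0 S (size S).-1).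
Proof.
move=> [mS maxS] mm nm; have [S0 sS uS m0 mn] := marked_pathE z0 mS.
set a := nth z0 S 0; have aS : a \in S by apply: mem_nth.
have [p pp pa] : exists2 p, path e m p & a = last m p.
  by apply/connectP; apply: tree_connect.
move: pa; case/shortenP: pp => {}p pp up _ pa.
have hp : has (near S) p.
  have := mem_last m p; rewrite -pa inE => /predU1P [am|ap].
    by case/negP: nm; apply/hasP; exists a; rewrite // am eqxx.
  by apply/hasP; exists a => //; apply/hasP; exists a; rewrite ?eqxx.
(* [x'] is the first vertex of the path near [S], and [x] is a vertex of [S] that witnesses this. *)
case/split_find: hp pp up {pa} => x' q q2 /hasP [x xS x'x] nq.
rewrite cat_path -cat_cons cat_uniq => /andP [pq _] /andP [uq _].
have nmq u : u \in m :: q -> ~~ near S u.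
  rewrite inE => /predU1P [-> //|uq']; apply: contra nq => nu.
  by apply/hasP; exists u.
have x'S : x' \notin S.
  apply/negP => x'S; have := nmq _ (mem_last m q) => /negP; apply.
  move: pq; rewrite rcons_path => /andP [_ ex'].
  by apply/hasP; exists x'; rewrite // ex' orbT.
have {}x'x : e x' x.
  by case/predU1P: x'x => // E; rewrite E xS in x'S.
set i := index x S; have iS : i < size S by rewrite index_mem.
have Ex : nth z0 S i = x by rewrite nth_index.
have dE : drop i S = x :: drop i.+1 S by rewrite (drop_nth z0) // Ex.
have sx : sorted e (x :: drop i.+1 S) by rewrite -dE drop_sorted.
have lastE : nth z0 S (size S).-1 = last x (drop i.+1 S).
  by rewrite nth_last -{1}(cat_take_drop i S) last_cat dE.
(* Otherwise rerouting the beginning of [S] to [m] through [x'] gives a longer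
   marked path. *)
have i2 : 1 < i.
  pose S' := m :: rcons q x' ++ drop i S.
  have sizeS' : size S' = (size q).+2 + (size S - i).
    by rewrite /= size_cat size_rcons size_drop.
  suff /maxS : marked_path e mk S'.
    by rewrite sizeS'; move: iS; clearbody i; clear; lia.
  apply: (marked_pathI (z := z0)) => //.
  - by rewrite /S' dE /= cat_path pq last_rcons /= x'x.
  - rewrite /S' -cat_cons cat_uniq uq drop_uniq // andbT /=.
    apply/hasPn => u /mem_drop uS'.
    rewrite -rcons_cons mem_rcons inE negb_or; apply/andP; split.
      by apply: contraNneq x'S => <-.
    apply/negP => /nmq /negP; apply; apply/hasP; exists u; rewrite ?eqxx //.
  - by rewrite nth_last /S' dE /= last_cat /= -lastE.
have farS j : 1 < j -> j < size S -> apart e a (nth z0 S j).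
  by move=> j1 jS; apply: tree_sorted_far.
have ax : apart e a x by rewrite -Ex farS.
have ax' : apart e a x'.
  rewrite /apart; apply/andP; split; first by apply: contraNneq x'S => ->.
  (* If [x'] were adjacent to [a], then [x] and [a] would be neighbors of [x'] joined along [S],
     hence equal. *)
  rewrite esym; apply/negP => ex'a; move: ax; rewrite /apart => /andP [/eqP + _]; apply.
  apply: (tree_neighbors treeT x'x ex'a).
  apply: (sorted_connect (s := S)) => //; first exact: off_sym.
  by case: (S) sS x'S => // y l ye x'l; apply: path_off.
split; first by apply: farS; rewrite ?ltn_predL // ltn_predRL (leq_ltn_trans i2).
have E1 := under_path R (a := a) pq.
rewrite last_rcons in E1; rewrite -E1; last first.
  rewrite -rcons_cons all_rcons ax' andTb; apply/allP => u /nmq nu.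
  exact: not_near_apart nu aS.
rewrite (under_edge R ax' ax x'x).
have E2 := under_path R (a := a) sx.
rewrite lastE E2 => [//|]; apply/allP => u; rewrite -dE => /(nthP z0) [j].
rewrite size_drop ltn_subRL => jS <-; rewrite nth_drop; apply: farS => //.
exact: leq_trans i2 (leq_addr _ _).
Qed.

(** If [m] were far from [S], the intervals of [m] and of the two ends of [S] would be pairwise
    apart and marked, hence form a chain under nesting. But each of the three either encloses both
    others or neither, so none could be the middle one. *)
Lemma marked_near_spine S m : longest_marked_path e mk S -> mk m -> near S m.
Proof.
move=> LS mm; apply: contraT => nm.
have [S0 sS uS m0 mn] := marked_pathE m LS.1.
have [az Ua] := under_first_last m LS mm nm.
have nm' : ~~ near (rev S) m by rewrite /near has_rev.
have [_] := under_first_last m (longest_marked_path_rev esym LS) mm nm'.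
rewrite size_rev !nth_rev ?subn1 ?prednK // subnn => Uz.
set a := nth m S 0 in m0 az Ua Uz; set z := nth m S (size S).-1 in mn az Ua Uz.
have aS : a \in S by apply: mem_nth.
have zS : z \in S by rewrite mem_nth // ltn_predL.
have am : apart e a m by apply: not_near_apart aS.
have zm : apart e z m by apply: not_near_apart zS.
have Um : under lo hi m z = under lo hi m a.
  rewrite /z nth_last /a nth0; case: (S) sS nm => // y l pl nm.
  apply: (under_path R pl); apply/allP => u ul; rewrite (apartC R).
  exact: not_near_apart nm ul.
have ma : apart e m a by rewrite (apartC R).
have mz : apart e m z by rewrite (apartC R).
have za : apart e z a by rewrite (apartC R).
move: Um; rewrite (under_marked R mm mn mz) (under_marked R mm m0 ma).
by rewrite Ua Uz (under_marked R mn m0 za); case: under.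
Qed.

End NearSpine.

(** * Blobs of unmarked vertices *)

Lemma eq_marked_path (T : finType) (e : rel T) (m m' : pred T) s :
  m =1 m' -> marked_path e m s = marked_path e m' s.
Proof. by move=> mm'; case: s => //= x p; rewrite !mm'. Qed.

Lemma eq_longest_marked_path (T : finType) (e : rel T) (m m' : pred T) s :
  m =1 m' -> longest_marked_path e m s -> longest_marked_path e m' s.
Proof.
move=> mm' [ms maxs]; split=> [|s']; rewrite -(eq_marked_path e _ mm') //.
exact: maxs.
Qed.

Lemma exists_longest_marked_path (T : finType) (e : rel T) (m : pred T) x :
  m x -> exists s, longest_marked_path e m s.
Proof.
move=> mx; pose P k := [exists t : k.-tuple T, marked_path e m t].
have exP : exists k, P k by exists 1; apply/existsP; exists [tuple x]; rewrite /= mx.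
have ubP k : P k -> k <= #|T|.
  case/existsP=> t /(marked_pathE x) [_ _ ut _ _].
  by rewrite -(size_tuple t) -(card_uniqP ut) max_card.
case: (ex_maxnP exP ubP) => k /existsP [t mt] maxk; exists t; split=> // s' ms'.
by rewrite size_tuple; apply: maxk; apply/existsP; exists (in_tuple s').
Qed.

Lemma longest_is_spine (T : finType) (e : rel T) (m : pred T) x s :
  m x -> longest_marked_path e m s -> is_spine e m s.
Proof. by move=> mx ls; rewrite /is_spine; case: existsP => // -[]; exists x. Qed.

Section Blob.

Variables (T : finType) (e : rel T) (m : pred T).
Hypothesis treeT : is_tree e.

Definition unmarked_edge : rel T := [rel a b | [&& e a b, ~~ m a & ~~ m b]].

Definition blob (v : T) : {set T} := [set u | connect unmarked_edge v u].

Lemma unmarked_edge_sym : symmetric unmarked_edge.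
Proof.
by move=> a b; rewrite /unmarked_edge /= (tree_sym treeT) [~~ m a && _]andbC.
Qed.

Lemma blob_unmarked v u : ~~ m v -> u \in blob v -> ~~ m u.
Proof.
rewrite inE => mv /connectP [p pp ->].
elim: p v mv pp => //= w p IH v mv /andP [/and3P [_ _ mw]]; exact: IH.
Qed.

Lemma blob_closed v u w : ~~ m v -> u \in blob v -> e u w -> ~~ m w -> w \in blob v.
Proof.
move=> mv uB euw mw; move: (uB); rewrite !inE => vu; apply: connect_trans vu _.
by apply: connect1; rewrite /unmarked_edge /= euw mw (blob_unmarked mv uB).
Qed.

Lemma blob_connect (r : rel T) v x y :
  {in blob v &, subrel unmarked_edge r} -> x \in blob v -> y \in blob v ->
  connect r x y.
Proof.
move=> sub xB; rewrite inE => vy; move: (xB); rewrite inE => vx.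
have : connect unmarked_edge x y.
  by rewrite (connect_trans _ vy) // (sym_connect_sym unmarked_edge_sym).
case/connectP=> p pp ->; elim: p x xB pp {vx} => //= z p IH x xB /andP [xz pp].
have zB : z \in blob v.
  by move: xB; rewrite !inE => vx; apply: connect_trans vx (connect1 xz).
exact: connect_trans (connect1 (sub _ _ xB zB xz)) (IH z zB pp).
Qed.

(** Otherwise the blob would be closed under adjacency and, the tree being connected, contain the
    marked vertex [x]. *)
Lemma blob_marked_neighbor v x : ~~ m v -> m x ->
  exists b y, [/\ b \in blob v, m y & e b y].
Proof.
move=> mv mx.
have [/existsP [b /existsP [y /and3P [? ? ?]]]|/existsPn H] :=
    boolP [exists b, exists y, [&& b \in blob v, m y & e b y]].
  by exists b, y.
have cl : closed e (blob v).
  apply: intro_closed; first exact: (sym_connect_sym (tree_sym treeT)).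
  move=> u w euw uB; apply: (blob_closed mv uB euw).
  by have /existsPn /(_ w) := H u; rewrite uB euw andbT.
have := closed_connect cl (tree_connect treeT v x); rewrite inE connect0 => /esym xB.
by have := blob_unmarked mv xB; rewrite mx.
Qed.

(* Two such neighbors would close a cycle through the blob and [S]. *)
Lemma blob_neighbor_unique S v b1 b2 m1 m2 :
  sorted e S -> {in S, forall u, u \notin blob v} -> ~~ m v ->
  b1 \in blob v -> b2 \in blob v -> e b1 m1 -> e b2 m2 -> m m1 -> m m2 ->
  near e S m1 -> near e S m2 -> m1 = m2.
Proof.
move=> sS SB mv b1B b2B e1 e2 mm1 mm2 n1 n2.
pose B := blob v.
(* [r] keeps the edges that touch the blob, [r'] those that avoid it. [m1] and [m2] are connected in
   both, yet no edge lies in both, so the common path is empty. *)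
pose r := [rel a b | e a b && ((a \in B) || (b \in B))].
pose r' := [rel a b | e a b && ~~ ((a \in B) || (b \in B))].
have mB w : m w -> w \notin B.
  by move=> mw; apply/negP => /(blob_unmarked mv); rewrite mw.
have c : connect r m1 m2.
  apply: (connect_trans (y := b1)).
    by apply: connect1; rewrite /r /= (tree_sym treeT) e1 /B b1B orbT.
  apply: (connect_trans (y := b2)); last by apply: connect1; rewrite /r /= e2 /B b2B.
  apply: blob_connect b1B b2B => a b aB bB /and3P [eab _ _].
  by rewrite /r /= eab /B aB.
have r'sym : symmetric r'.
  by move=> a b; rewrite /r' /= (tree_sym treeT) [(a \in B) || _]orbC.
have toS w : m w -> near e S w -> exists2 s, s \in S & connect r' w s.
  move=> mw /hasP [s sS' ws]; exists s => //; case/predU1P: ws => [->|ws] //.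
  by apply: connect1; rewrite /r' /= ws negb_or mB // SB.
have c' : connect r' m1 m2.
  have [s1 s1S c1] := toS _ mm1 n1; have [s2 s2S c2] := toS _ mm2 n2.
  apply: connect_trans c1 _; rewrite (sym_connect_sym r'sym).
  apply: connect_trans c2 _; apply: (sorted_connect (s := S)) => //.
  apply: (sub_in_sorted (P := mem S)) sS; last by apply/allP.
  by move=> a b aS bS eab; rewrite /r' /= eab negb_or !SB.
have rr' : connect [rel a b | r a b && r' a b] m1 m2.
  by apply: (tree_connectI treeT) c c' => a b /andP [].
case/connectP: rr' => -[|z p] /=; first by [].
by case/andP=> /andP [/andP [_ H]] /andP [_ /negP].
Qed.

End Blob.

(** * Correcting the labels of a realized marked tree *)

Section Relabeling.

Variables (T : finType) (e : rel T) (lab : T -> {set 'I_2}).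
Hypotheses (treeT : is_tree e) (labT : forall v : T, is_label (lab v)).

Lemma is_label_rep lab' v : representable e lab' -> is_label (lab' v).
Proof.
by case=> lo [hi [N R]]; rewrite (rep_lab R); do 2 eexists.
Qed.

Lemma marked_label (A : {set 'I_2}) : is_mark A -> A = [set ord0; ord_max].
Proof. by move/eqP. Qed.

Lemma unmarked_label (A : {set 'I_2}) : is_label A -> ~~ is_mark A ->
  A = [set ord0] \/ A = [set ord_max].
Proof.
case=> i [j ->]; case: (ord2P i) => ->; case: (ord2P j) => ->; rewrite ?setUid;
  rewrite /is_mark ?eqxx //; first by left.
  by rewrite setUC eqxx.
by right.
Qed.

Lemma unmarked_label_third (A B C : {set 'I_2}) :
  is_label A -> is_label B -> is_label C ->
  ~~ is_mark A -> ~~ is_mark B -> ~~ is_mark C -> A != B -> C != B -> A = C.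
Proof.
move=> lA lB lC mA mB mC.
by case: (unmarked_label lA mA) => ->; case: (unmarked_label lB mB) => ->;
  case: (unmarked_label lC mC) => ->; rewrite ?eqxx.
Qed.

Lemma eq_representable lab' : lab' =1 lab -> representable e lab' -> representable e lab.
Proof.
move=> E [lo [hi [N [lt loI hiI lohi eE lE]]]]; exists lo, hi, N; split=> // x.
by rewrite -E.
Qed.

Definition candidate (lab' : T -> {set 'I_2}) : Prop :=
  representable e lab' /\ marked lab' =1 marked lab.

(** There are only two unmarked labels, so if [v] has the wrong one, exchanging the components
    corrects it. *)
Lemma align v lab' : candidate lab' -> ~~ marked lab v ->
  exists2 lab'', candidate lab'' & lab'' v = lab v.
Proof.
case=> rep' mE mv; have [E|nE] := eqVneq (lab' v) (lab v).
  by exists lab'.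
have [lab'' [rep'' mE'' d]] := swap_components rep'.
have m'' : marked lab'' =1 marked lab by move=> x; rewrite mE''.
exists lab'' => //; apply: (unmarked_label_third (B := lab' v)).
- exact: is_label_rep.
- exact: is_label_rep.
- exact: labT.
- by rewrite -/(marked lab'' v) m''.
- by rewrite -/(marked lab' v) mE.
- exact: mv.
- by apply: d; rewrite mE.
- by rewrite eq_sym.
Qed.

Hypothesis edgeT : forall v w, e v w -> ~~ marked lab v -> ~~ marked lab w ->
  lab v = lab w.

Lemma eq_marked_label lab' x : candidate lab' -> marked lab x -> lab' x = lab x.
Proof.
move=> [_ mE] mx; rewrite (marked_label mx) (@marked_label (lab' x)) //.
by rewrite -/(marked lab' x) mE.
Qed.

Lemma blob_const lab' v u : candidate lab' -> ~~ marked lab v ->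
  u \in blob e (marked lab) v -> lab' u = lab' v /\ lab u = lab v.
Proof.
move=> [[lo [hi [N R]]] mE] mv; rewrite inE => /connectP [p pp ->].
elim: p v mv pp => //= w p IH v mv.
move=> /andP [/and3P [vw _ mw] /(IH w mw) [-> ->]]; split.
  by apply/esym/(rep_unmarked_edge R vw); rewrite mE.
exact/esym/edgeT.
Qed.

(** Induction on a bound for the number of wrong labels. The blob of a wrong vertex is wrong
    throughout and misses [S]; flipping it corrects all its labels and changes no other. *)
Lemma repair S k lab' : longest_marked_path e (marked lab) S ->
  {in S, lab' =1 lab} -> candidate lab' -> #|[set x | lab' x != lab x]| <= k ->
  representable e lab.
Proof.
move=> LS; elim: k lab' => [|k IH] lab' SE cand.
  rewrite leqn0 cards_eq0 => /eqP E; apply: eq_representable cand.1 => x.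
  by apply/eqP; have := in_set0 x; rewrite -E inE => /negbFE.
have [E _|[v]] := set_0Vmem [set x | lab' x != lab x].
  by apply: (IH lab') => //; rewrite E cards0.
rewrite inE => dv le_k; have [rep' mE] := cand.
have mv : ~~ marked lab v by apply: contraNN dv => /(eq_marked_label cand) ->.
set B := blob e (marked lab) v.
have dB u : u \in B -> lab' u != lab u.
  by case/(blob_const cand mv) => -> ->.
have SB u : u \in S -> u \notin B.
  by move=> /SE uE; apply/negP => /dB; rewrite uE eqxx.
have [lo [hi [N R]]] := rep'.
have LS' : longest_marked_path e (marked lab') S.
  by apply: eq_longest_marked_path LS => x.
have [S0 sS uS mS0 _] := marked_pathE v LS.1.
have [b [m [bB mm bm]]] := blob_marked_neighbor treeT mv mS0.
have nearS x : marked lab x -> near e S x.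
  by move=> mx; apply: (marked_near_spine treeT R LS'); rewrite mE.
(* A neighbor outside the blob is marked, hence near [S], and a blob off [S] has only one such
   neighbor. *)
have outB x y : x \in B -> y \notin B -> e x y -> y = m.
  move=> xB yB xy; have my : marked lab y.
    by apply: contraT => my; rewrite (blob_closed mv xB xy my) in yB.
  by apply: (blob_neighbor_unique treeT sS SB mv xB bB xy bm); rewrite ?nearS.
have mBm : marked lab' m by rewrite mE.
have unB : {in B, forall x, ~~ marked lab' x}.
  by move=> x xB; rewrite mE (blob_unmarked mv xB).
have sameB : {in B &, forall x y, lab' x = lab' y}.
  move=> x y /(blob_const cand mv) [-> _].
  by move=> /(blob_const cand mv) [-> _].
have [lab'' [rep'' mE'' dB'' sB'']] := flip_block rep' mBm unB sameB outB.
have cand'' : candidate lab'' by split=> // x; rewrite mE''.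
have EB x : x \in B -> lab'' x = lab x.
  move=> xB; apply: (unmarked_label_third (B := lab' x)).
  - exact: is_label_rep.
  - exact: is_label_rep.
  - exact: labT.
  - by rewrite -/(marked lab'' x) cand''.2 (blob_unmarked mv xB).
  - exact: unB.
  - exact: (blob_unmarked mv xB).
  - exact: dB''.
  - by rewrite eq_sym dB.
apply: (IH lab'') => // [x xS|]; first by rewrite sB'' ?SB // SE.
rewrite -ltnS; apply: leq_trans le_k; apply: proper_card; apply/properP; split.
  apply/subsetP => x; rewrite !inE; have [/EB ->|/sB'' -> //] := boolP (x \in B).
  by rewrite eqxx.
exists v; rewrite !inE // EB ?eqxx //; first by rewrite inE connect0.
Qed.

End Relabeling.

(** * Assembling the equivalence *)

Theorem theorem2 (T : finType) (e : rel T) (lab : T -> {set 'I_2})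
    (treeT : is_tree e) (labT : forall v : T, is_label (lab v)) :
  labeled_intersection_graph e lab <->
  [/\ marked_intersection_graph e (marked lab),
      forall v w : T, e v w -> ~~ marked lab v -> ~~ marked lab w ->
        lab v = lab w
    & forall (S : seq T) (v w : T),
        is_spine e (marked lab) S -> v \in S -> w \in S ->
        ~~ marked lab v -> ~~ marked lab w ->
        (lab v = lab w <-> ~~ odd (count (marked lab) (between S v w)))].
Proof.
split=> [labIG|[[n [D [f [fbij fe fm]]]] edgeT spineT]].
  have /labeled_chord_rep [lo [hi [N R]]] := labIG.
  split.
  - have [n [D [f [fbij fe fl]]]] := labIG; exists n, D, f; split=> // x.
    by rewrite /marked fl.
  - exact: rep_unmarked_edge R.
  - move=> S v w; rewrite /is_spine; case: ifP => [_ [mS _] vS wS mv mw|_ -> //].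
    rewrite -(between_parity treeT R mS vS wS mv mw).
    by split=> [->|/eqP].
pose lab0 x := chord_label D (f x).
have cand0 : candidate e lab lab0.
  split; first by apply/labeled_chord_rep; exists n, D, f.
  by move=> x; rewrite -fm.
apply/labeled_chord_rep.
have [/existsP [m0 mm0]|/existsPn unm] := boolP [exists x, marked lab x]; last first.
  (* Without marked vertices the whole tree is one blob, so aligning a single vertex aligns all of
     them. *)
  have /card_gt0P [v0 _] : 0 < #|T| by case: treeT.
  have [lab' cand E] := align labT cand0 (unm v0).
  apply: eq_representable cand.1 => x.
  have [|-> ->] // := blob_const edgeT cand (unm v0) (u := x).
  rewrite inE; apply: connect_sub (tree_connect treeT v0 x) => a b eab.
  by apply: connect1; rewrite /unmarked_edge /= eab !unm.
have [S LS] := exists_longest_marked_path e mm0.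
have spS := longest_is_spine mm0 LS.
have [/allP allS|/allPn [v0 v0S mv0]] := boolP (all (marked lab) S).
  apply: (repair treeT labT edgeT LS _ cand0 (leqnn _)) => x /allS.
  exact: (eq_marked_label cand0).
(* Once [v0] is aligned, the rest of the spine agrees as well: by [between_parity] for [lab'] and
   condition (3) for [lab], the same parity decides whether an unmarked [x] of the spine has the
   label of [v0]. *)
have [lab' cand E] := align labT cand0 mv0.
apply: (repair treeT labT edgeT LS _ cand (leqnn _)) => x xS.
have [|mx] := boolP (marked lab x); first exact: (eq_marked_label cand).
have [[lo [hi [N R]]] mE] := cand.
have mS : marked_path e (marked lab') S by rewrite (eq_marked_path e _ mE); case: LS.
have := spineT S x v0 spS xS v0S mx mv0; rewrite -(eq_count mE).
rewrite -(between_parity treeT R mS xS v0S) ?mE // => H.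
have [E'|nE] := eqVneq (lab' x) (lab' v0).
  by rewrite E' E; apply/esym/H; rewrite E'.
apply: (unmarked_label_third (B := lab v0)) => //.
- exact: is_label_rep cand.1.
- by rewrite -/(marked lab' x) mE.
- by rewrite -E.
- by apply/eqP => /H; apply/negP.
Qed.
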